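(* Let $a_2,a_3,b_2,b_3$ be nonzero real numbers such that $a_2b_2\neq -a_3b_3$ and $(a_2,b_2)\neq(-a_3,-b_3)$. Let $\xi_1,\xi_2,\xi_3,\xi_4$ be independent real-valued random variables whose characteristic functions vanish nowhere on $\mathbb{R}$, and assume $\xi_2$ and $\xi_3$ are identically distributed. Put $L_1=\xi_1+a_2\xi_2+a_3\xi_3$ and $L_2=b_2\xi_2+b_3\xi_3+\xi_4$. Let $\eta_1,\eta_2,\eta_3,\eta_4$ be any independent real-valued random variables whose characteristic functions vanish nowhere on $\mathbb{R}$, with $\eta_2$ and $\eta_3$ identically distributed, and put $M_1=\eta_1+a_2\eta_2+a_3\eta_3$, $M_2=b_2\eta_2+b_3\eta_3+\eta_4$. If the random vectors $(L_1,L_2)$ and $(M_1,M_2)$ have the same distribution, then there exist real numbers $\alpha_1,\alpha_2,\alpha_3,\alpha_4$ such that for each $j=1,2,3,4$ the distribution of $\eta_j$ equals the distribution of $\xi_j+\alpha_j$ (i.e. the distribution of $(L_1,L_2)$ determines the distributions of the $\xi_j$ up to shift). *)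

(* Defs.v *)
From HB Require Import structures.
From mathcomp Require Import all_boot all_order all_algebra.
From mathcomp Require Import all_classical all_reals all_analysis.
From mathcomp Require Import complex.
Set Implicit Arguments. Unset Strict Implicit. Unset Printing Implicit Defensive.
Import Order.TTheory GRing.Theory Num.Theory.
Local Open Scope classical_set_scope.
Local Open Scope ring_scope.

(* Characteristic function phi_X(t) = E[exp(i t X)] = E[cos(tX)] + i E[sin(tX)],
   a complex number (the expectations are finite since cos, sin are bounded). *)
Definition charfun d (T : measurableType d) (R : realType) (P : probability T R)
  (X : T -> R) (t : R) : R[i] :=
  Complex (fine ('E_P[fun w => cos (t * X w)]))
          (fine ('E_P[fun w => sin (t * X w)])).

Definition charfun_nowhere_zero d (T : measurableType d) (R : realType)
  (P : probability T R) (X : T -> R) : Prop :=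
  forall t : R, charfun P X t != 0.

(* Mutual independence of four real random variables:
   P(X1 in B1, ..., X4 in B4) = prod_i P(Xi in Bi) for all Borel sets Bi
   (taking some Bi = setT gives the product rule for every subfamily). *)
Definition independent4 d (T : measurableType d) (R : realType)
  (P : probability T R) (X1 X2 X3 X4 : T -> R) : Prop :=
  forall B1 B2 B3 B4 : set R,
    measurable B1 -> measurable B2 -> measurable B3 -> measurable B4 ->
    P (X1 @^-1` B1 `&` X2 @^-1` B2 `&` X3 @^-1` B3 `&` X4 @^-1` B4) =
    (P (X1 @^-1` B1) * P (X2 @^-1` B2) * P (X3 @^-1` B3) * P (X4 @^-1` B4))%E.

Definition same_law d d' (T : measurableType d) (T' : measurableType d')
  (R : realType) (P : probability T R) (Q : probability T' R)
  (X : T -> R) (Y : T' -> R) : Prop :=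
  forall B : set R, measurable B -> P (X @^-1` B) = Q (Y @^-1` B).

Definition same_law2 d d' (T : measurableType d) (T' : measurableType d')
  (R : realType) (P : probability T R) (Q : probability T' R)
  (X1 X2 : T -> R) (Y1 Y2 : T' -> R) : Prop :=
  forall A : set (R * R), measurable A ->
    P ((fun w => (X1 w, X2 w)) @^-1` A) = Q ((fun w => (Y1 w, Y2 w)) @^-1` A).

(* Main.v *)
Require Import Defs.
From HB Require Import structures.
From mathcomp Require Import all_boot all_order all_algebra.
From mathcomp Require Import all_classical all_reals all_analysis.
From mathcomp Require Import complex.
From mathcomp Require Import finmap measurable_realfun ring lra.
Import Order.TTheory GRing.Theory Num.Theory.
Import numFieldNormedType.Exports HBSimple HBNNSimple.
Local Open Scope classical_set_scope.
Local Open Scope ring_scope.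
Set Implicit Arguments.
Unset Strict Implicit.
Unset Printing Implicit Defensive.

(* The ratios u_j of the characteristic functions of eta_j and xi_j satisfy
   u_1(s) u(a2 s + b2 t) u(a3 s + b3 t) u_4(t) = 1 with u = u_2 = u_3.  If
   (a2, b2) and (a3, b3) are independent, exchanging increments of s and of t
   shows that B(h, k) = u(h + k) / (u(h) u(k)) is bimultiplicative; since
   u(-t) is the conjugate of u(t), B is positive, so B(h, k) = exp(c h k) with
   c (a2 b2 + a3 b3) = 0, and u is a continuous character.  If (a3, b3) =
   c (a2, b2), then u(x) u(c x) is a character exp(i k x), and
   r(x) = u(x) exp(-i k x / (1 + c)) satisfies r(x) r(c x) = 1, hence
   r(c^2 x) = r(x), which forces r = 1 by continuity.  Either way
   u(t) = exp(i alpha t), and likewise for u_1 and u_4.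

   Uniqueness of characteristic functions is obtained without Fourier
   inversion: the characteristic function determines E[f(X)] for every
   trigonometric polynomial f, and the indicator of ]c, +oo[ is an iterated
   bounded pointwise limit of trigonometric polynomials. *)

(** * Bounded measurable functions *)

(** The test functions used throughout: integrable under every probability and stable under sums,
    products and bounded pointwise limits, which keeps integrability conditions uniform. *)
Definition bmeas {d} {S : measurableType d} {R : realType} (f : S -> R) :=
  measurable_fun setT f /\ exists M : R, forall x, `|f x| <= M.

Lemma bmeas_cst d (S : measurableType d) (R : realType) (k : R) :
  bmeas (fun _ : S => k).
Proof. by split; [exact: measurable_cst|exists `|k|]. Qed.

Lemma bmeasD d (S : measurableType d) (R : realType) (f g : S -> R) :
  bmeas f -> bmeas g -> bmeas (fun x => f x + g x).
Proof.
move=> [mf [M fM]] [mg [N gN]]; split; first exact: measurable_funD.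
by exists (M + N) => x; rewrite (le_trans (ler_normD _ _))// lerD.
Qed.

Lemma bmeasM d (S : measurableType d) (R : realType) (f g : S -> R) :
  bmeas f -> bmeas g -> bmeas (fun x => f x * g x).
Proof.
move=> [mf [M fM]] [mg [N gN]]; split; first exact: measurable_funM.
by exists (M * N) => x; rewrite normrM ler_pM.
Qed.

Lemma bmeasZ d (S : measurableType d) (R : realType) (k : R) (f : S -> R) :
  bmeas f -> bmeas (fun x => k * f x).
Proof. by move=> bf; apply: bmeasM => //; exact: bmeas_cst. Qed.

Lemma bmeas_indic d (S : measurableType d) (R : realType) (A : set S) :
  measurable A -> bmeas (\1_A : S -> R).
Proof.
move=> mA; split; first exact: measurable_indic.
by exists 1 => x; rewrite indicE normr_nat lern1 leq_b1.
Qed.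

Lemma bmeas_comp d d' (S : measurableType d) (T : measurableType d')
    (R : realType) (f : S -> R) (X : T -> S) :
  bmeas f -> measurable_fun setT X -> bmeas (fun w => f (X w)).
Proof.
move=> [mf [M fM]] mX; split; last by exists M => x.
exact: (measurableT_comp mf).
Qed.

Lemma bmeas_integrable d (S : measurableType d) (R : realType)
    (P : probability S R) (f : S -> R) :
  bmeas f -> P.-integrable setT (EFin \o f).
Proof.
move=> [mf [M fM]]; apply: measurable_bounded_integrable => //.
  by rewrite (le_lt_trans (probability_le1 P _))// ltry.
exists M; split; first exact: num_real.
by move=> N MN x _ /=; rewrite (le_trans (fM x))// ltW.
Qed.

Lemma bmeas_RintegralD d (S : measurableType d) (R : realType)
    (P : probability S R) (k : R) (f g : S -> R) :
  bmeas f -> bmeas g ->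
  \int[P]_x (k * f x + g x) = k * \int[P]_x f x + \int[P]_x g x.
Proof.
move=> bf bg; rewrite RintegralD//; last 2 first.
- by apply: bmeas_integrable; exact: bmeasZ.
- exact: bmeas_integrable.
by rewrite RintegralZl//; exact: bmeas_integrable.
Qed.

(** Dominated convergence with a constant bound. That the limit is again a test function is returned
    too, because such limits are iterated later. *)
Lemma bounded_convergence d (S : measurableType d) (R : realType)
    (P : probability S R) (f_ : nat -> S -> R) (f : S -> R) (M : R) :
  (forall n, measurable_fun setT (f_ n)) ->
  (forall n x, `|f_ n x| <= M) -> (forall x, f_ ^~ x @ \oo --> f x) ->
  bmeas f /\ (\int[P]_x f_ n x)%R @[n --> \oo] --> \int[P]_x f x.
Proof.
move=> mf fM cf.
have mflim : measurable_fun setT f.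
  by apply: (@measurable_fun_cvg _ _ _ _ f_).
have fM' x : `|f x| <= M.
  rewrite ler_norml; apply/andP; split.
    apply: (cvgr_to_ge (cf x)); apply: nearW => n.
    by have := fM n x; rewrite ler_norml => /andP[].
  apply: (cvgr_to_le (cf x)); apply: nearW => n.
  by have := fM n x; rewrite ler_norml => /andP[].
have bf : bmeas f by split => //; exists M.
split => //; apply: fine_cvg; rewrite fineK; last first.
  by apply: integrable_fin_num => //; exact: bmeas_integrable.
apply: (@dominated_cvg _ _ _ P setT measurableT
  (fun n x => (f_ n x)%:E) (EFin \o f) (cst M%:E)) => //.
- by move=> n; apply/measurable_EFinP.
- by move=> x _; apply: cvg_EFin; [exact: nearW|exact: cf].
- by apply: (@bmeas_integrable _ _ _ P (fun=> M)); exact: bmeas_cst.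
- by move=> n x _ /=; rewrite lee_fin.
Qed.

(** Indicators give simple functions by linearity, simple functions give nonnegative bounded
    functions by increasing approximation, and adding the bound [M] reduces the general case to the
    nonnegative one. *)
Lemma bmeas_ind d (S : measurableType d) (R : realType)
    (C : (S -> R) -> Prop) :
  (forall A, measurable A -> C \1_A) ->
  (forall k f g, bmeas f -> bmeas g -> C f -> C g ->
     C (fun x => k * f x + g x)) ->
  (forall (f_ : nat -> S -> R) (f : S -> R) (M : R),
     (forall n, measurable_fun setT (f_ n)) ->
     (forall n x, `|f_ n x| <= M) -> (forall x, f_ ^~ x @ \oo --> f x) ->
     (forall n, C (f_ n)) -> C f) ->
  forall f, bmeas f -> C f.
Proof.
move=> Cindic Clin Clim f [mf [M fM]].
have C0 : C (fun=> 0).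
  have -> : (fun=> 0) = \1_set0 :> (S -> R) by rewrite indic0.
  exact: Cindic.
have Csum n (c : nat -> R) (A : nat -> set S) :
    (forall i, measurable (A i)) ->
    bmeas (fun x => \sum_(i < n) c i * \1_(A i) x) /\
    C (fun x => \sum_(i < n) c i * \1_(A i) x).
  move=> mA; elim: n => [|n [IHb IHC]].
    have -> : (fun x => \sum_(i < 0) c i * \1_(A i) x) = (fun=> 0).
      by apply/funext => x; rewrite big_ord0.
    by split => //; exact: bmeas_cst.
  have -> : (fun x => \sum_(i < n.+1) c i * \1_(A i) x) =
      (fun x => c n * \1_(A n) x + \sum_(i < n) c i * \1_(A i) x).
    by apply/funext => x; rewrite big_ord_recr/= addrC.
  have bA := bmeas_indic R (mA n).
  split; first by apply: bmeasD => //; exact: bmeasZ.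
  by apply: Clin => //; exact: Cindic.
have Cpos (g : S -> R) (N : R) : measurable_fun setT g ->
    (forall x, 0 <= g x <= N) -> C g.
  move=> mg gN.
  have mEg : measurable_fun setT (EFin \o g) by apply/measurable_EFinP.
  have g0 x : setT x -> (0 <= (EFin \o g) x)%E.
    by move=> _ /=; rewrite lee_fin; case/andP: (gN x).
  pose g_ := nnsfun_approx measurableT mEg.
  apply: (Clim (fun n => g_ n) g N).
  - by move=> n; exact: measurable_funPT.
  - move=> n x; rewrite ger0_norm//.
    rewrite -lee_fin (le_trans _ (_ : ((g x)%:E <= _)%E))//.
      rewrite /g_ nnsfun_approxE; exact: (le_approx _ g0).
    by rewrite lee_fin; case/andP: (gN x).
  - move=> x.
    have := @cvg_nnsfun_approx _ _ _ _ measurableT _ mEg g0 x I.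
    by move/fine_cvg.
  - move=> n.
    (* A simple function is the sum, over its finite range, of value times indicator of level set;
       listing the range as a sequence gives the form handled by [Csum]. *)
    rewrite (funext (fimfunEord (g_ n))).
    set r := enum_fset _.
    apply: (Csum _ (fun i => r`_i) (fun i => g_ n @^-1` [set r`_i]) _).2 => i.
    exact: measurable_sfunP.
have -> : f = (fun x => - M * \1_setT x + (f x + M)).
  by apply/funext => x; rewrite indicT mulr1 addrC addrK.
apply: Clin.
- exact: bmeas_indic.
- by apply: bmeasD; [split => //; exists M|exact: bmeas_cst].
- exact: Cindic.
- apply: (Cpos _ (M + M)%R); first by apply: measurable_funD.
  by move=> x; have := fM x; rewrite ler_norml => /andP[? ?]; apply/andP; split; lra.
Qed.

(** * Expectations under equal laws and under independence *)

Lemma Rintegral_indic_comp d d' (S : measurableType d) (T : measurableType d')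
    (R : realType) (P : probability T R) (X : T -> S) (A : set S) :
  measurable_fun setT X -> measurable A ->
  \int[P]_w (\1_A (X w) : R) = fine (P (X @^-1` A)).
Proof.
move=> mX mA; rewrite /Rintegral; congr fine.
have mXA : measurable (X @^-1` A) by rewrite -[X in measurable X]setTI; exact: mX.
by rewrite -[in RHS](setIT (X @^-1` A)) -integral_indic.
Qed.

Lemma eq_law_Rintegral d d1 d2 (S : measurableType d) (T : measurableType d1)
    (T' : measurableType d2) (R : realType) (P : probability T R)
    (Q : probability T' R) (X : T -> S) (Y : T' -> S) :
  measurable_fun setT X -> measurable_fun setT Y ->
  (forall A, measurable A -> P (X @^-1` A) = Q (Y @^-1` A)) ->
  forall f : S -> R, bmeas f -> \int[P]_w f (X w) = \int[Q]_w f (Y w).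
Proof.
move=> mX mY XY; apply: bmeas_ind => [A mA|k f g bf bg IHf IHg|f_ f M mf fM cf IH].
- by rewrite !Rintegral_indic_comp// XY.
- rewrite !bmeas_RintegralD ?IHf ?IHg//; exact: bmeas_comp.
- have [_ cX] := @bounded_convergence _ _ _ P (fun n w => f_ n (X w))
    (fun w => f (X w)) M (fun n => measurableT_comp (mf n) mX)
    (fun n w => fM n (X w)) (fun w => cf (X w)).
  have [_ cY] := @bounded_convergence _ _ _ Q (fun n w => f_ n (Y w))
    (fun w => f (Y w)) M (fun n => measurableT_comp (mf n) mY)
    (fun n w => fM n (Y w)) (fun w => cf (Y w)).
  apply: (cvg_unique _ cX) => //.
  by rewrite (_ : (fun n => _) = (fun n => \int[Q]_w f_ n (Y w)))//; apply/funext.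
Qed.

(** Meant for [V] the product of the remaining factors and [K] the product of their expectations: a
    single indicator is replaced by an arbitrary test function. *)
Lemma Rintegral_indic_mul d (T : measurableType d)
    (R : realType) (P : probability T R) (X : T -> R) (V : T -> R) (K : R) :
  measurable_fun setT X -> bmeas V ->
  (forall A, measurable A -> \int[P]_w (\1_A (X w) * V w) =
     \int[P]_w \1_A (X w) * K) ->
  forall f : R -> R, bmeas f -> \int[P]_w (f (X w) * V w) = \int[P]_w f (X w) * K.
Proof.
move=> mX bV H; apply: bmeas_ind => [//|k f g bf bg IHf IHg|f_ f M mf fM cf IH].
- rewrite bmeas_RintegralD; [|exact: bmeas_comp..].
  rewrite mulrDl -IHg -mulrA -IHf -bmeas_RintegralD.
  + by apply: eq_Rintegral => w _; rewrite mulrDl mulrA.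
  + by apply: bmeasM => //; exact: bmeas_comp.
  + by apply: bmeasM => //; exact: bmeas_comp.
- have [_ cX] := @bounded_convergence _ _ _ P (fun n w => f_ n (X w))
    (fun w => f (X w)) M (fun n => measurableT_comp (mf n) mX)
    (fun n w => fM n (X w)) (fun w => cf (X w)).
  case: (bV) => mV [N VN].
  have fVMN n w : `|f_ n (X w) * V w| <= M * N by rewrite normrM ler_pM.
  have [_ cY] := @bounded_convergence _ _ _ P (fun n w => f_ n (X w) * V w)
    (fun w => f (X w) * V w) (M * N)
    (fun n => measurable_funM (measurableT_comp (mf n) mX) mV)
    fVMN
    (fun w => cvgM (cf (X w)) (cvg_cst _)).
  apply: (cvg_unique _ cY) => //.
  rewrite (_ : (fun n => _) = (fun n => \int[P]_w f_ n (X w) * K)); last exact/funext.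
  by apply: cvgM => //; exact: cvg_cst.
Qed.

(** Independence is the case of four indicators; these are replaced by test functions one coordinate
    at a time, the factor under replacement being moved to the front. *)
Lemma independent4_Rintegral d (T : measurableType d) (R : realType)
    (P : probability T R) (X1 X2 X3 X4 : T -> R) :
  measurable_fun setT X1 -> measurable_fun setT X2 ->
  measurable_fun setT X3 -> measurable_fun setT X4 ->
  independent4 P X1 X2 X3 X4 ->
  forall g1 g2 g3 g4 : R -> R, bmeas g1 -> bmeas g2 -> bmeas g3 -> bmeas g4 ->
  \int[P]_w (g1 (X1 w) * (g2 (X2 w) * (g3 (X3 w) * g4 (X4 w)))) =
  \int[P]_w g1 (X1 w) * (\int[P]_w g2 (X2 w) *
    (\int[P]_w g3 (X3 w) * \int[P]_w g4 (X4 w))).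
Proof.
move=> m1 m2 m3 m4 ind.
have bi A : measurable A -> bmeas (\1_A : R -> R) by exact: bmeas_indic.
have bc g X : bmeas g -> measurable_fun setT X -> bmeas (fun w : T => g (X w) : R).
  exact: bmeas_comp.
have mX X A : measurable_fun setT X -> measurable A -> measurable (X @^-1` A : set T).
  by move=> mX mA; rewrite -[X in measurable X]setTI; exact: mX.
have H0 A1 A2 A3 A4 : measurable A1 -> measurable A2 -> measurable A3 ->
    measurable A4 ->
    \int[P]_w (\1_A1 (X1 w) * (\1_A2 (X2 w) * (\1_A3 (X3 w) * \1_A4 (X4 w)))) =
    \int[P]_w \1_A1 (X1 w) * (\int[P]_w \1_A2 (X2 w) *
    (\int[P]_w \1_A3 (X3 w) * \int[P]_w (\1_A4 (X4 w) : R))).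
  move=> mA1 mA2 mA3 mA4; rewrite !Rintegral_indic_comp//.
  have := ind _ _ _ _ mA1 mA2 mA3 mA4; move/(congr1 fine).
  have fP X A : measurable_fun setT X -> measurable A -> P (X @^-1` A) \is a fin_num.
    by move=> ? ?; rewrite fin_num_measure//; exact: mX.
  rewrite !fineM ?fin_numM ?fP// !mulrA => <-.
  rewrite -[X in fine (P X)]setIT -integral_indic//; last first.
    by do !apply: measurableI; exact: mX.
  congr fine; apply: eq_integral => w _; congr EFin.
  by rewrite !indicE !in_setI -!mulnb !natrM !mulrA.
have C1 (g1 : R -> R) : bmeas g1 -> forall A2 A3 A4, measurable A2 -> measurable A3 ->
    measurable A4 ->
    \int[P]_w (g1 (X1 w) * (\1_A2 (X2 w) * (\1_A3 (X3 w) * \1_A4 (X4 w)))) =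
    \int[P]_w g1 (X1 w) * (\int[P]_w \1_A2 (X2 w) *
    (\int[P]_w \1_A3 (X3 w) * \int[P]_w (\1_A4 (X4 w) : R))).
  move=> bg1 A2 A3 A4 mA2 mA3 mA4; apply: Rintegral_indic_mul => //.
    by apply: bmeasM; [|apply: bmeasM]; apply: bc => //; exact: bi.
  by move=> A1 mA1; exact: H0.
have C2 (g1 g2 : R -> R) : bmeas g1 -> bmeas g2 -> forall A3 A4, measurable A3 ->
    measurable A4 ->
    \int[P]_w (g1 (X1 w) * (g2 (X2 w) * (\1_A3 (X3 w) * \1_A4 (X4 w)))) =
    \int[P]_w g1 (X1 w) * (\int[P]_w g2 (X2 w) *
    (\int[P]_w \1_A3 (X3 w) * \int[P]_w (\1_A4 (X4 w) : R))).
  move=> bg1 bg2 A3 A4 mA3 mA4.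
  rewrite [RHS]mulrCA -(@Rintegral_indic_mul _ _ _ P X2
    (fun w => g1 (X1 w) * (\1_A3 (X3 w) * \1_A4 (X4 w))))//.
  + by apply: eq_Rintegral => w _; rewrite mulrCA.
  + by apply: bmeasM; [exact: bc|apply: bmeasM; apply: bc => //; exact: bi].
  + move=> A2 mA2; rewrite mulrCA -C1//.
    by apply: eq_Rintegral => w _; rewrite mulrCA.
have C3 (g1 g2 g3 : R -> R) : bmeas g1 -> bmeas g2 -> bmeas g3 -> forall A4,
    measurable A4 ->
    \int[P]_w (g1 (X1 w) * (g2 (X2 w) * (g3 (X3 w) * \1_A4 (X4 w)))) =
    \int[P]_w g1 (X1 w) * (\int[P]_w g2 (X2 w) *
    (\int[P]_w g3 (X3 w) * \int[P]_w (\1_A4 (X4 w) : R))).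
  move=> bg1 bg2 bg3 A4 mA4.
  have sw (x y z t : R) : x * (y * (z * t)) = z * (x * (y * t)) by ring.
  rewrite [RHS]sw -(@Rintegral_indic_mul _ _ _ P X3
    (fun w => g1 (X1 w) * (g2 (X2 w) * \1_A4 (X4 w))))//.
  + by apply: eq_Rintegral => w _; rewrite sw.
  + by apply: bmeasM; [exact: bc|apply: bmeasM; apply: bc => //; exact: bi].
  + move=> A3 mA3; rewrite -sw -C2//.
    by apply: eq_Rintegral => w _; rewrite sw.
move=> g1 g2 g3 g4 bg1 bg2 bg3 bg4.
have sw (x y z t : R) : x * (y * (z * t)) = t * (x * (y * z)) by ring.
rewrite [RHS]sw -(@Rintegral_indic_mul _ _ _ P X4
    (fun w => g1 (X1 w) * (g2 (X2 w) * g3 (X3 w))))//.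
- by apply: eq_Rintegral => w _; rewrite sw.
- by apply: bmeasM; [exact: bc|apply: bmeasM; exact: bc].
- move=> A4 mA4; rewrite -sw -C3//.
  by apply: eq_Rintegral => w _; rewrite sw.
Qed.

(** * Characteristic functions *)

Lemma bmeas_cos (R : realType) (t : R) : bmeas (fun x => cos (t * x)).
Proof.
split; last by exists 1 => x; exact: cos_max.
apply: continuous_measurable_fun => x.
apply: continuous_comp; last exact: continuous_cos.
by apply: cvgM; [exact: cvg_cst|exact: cvg_id].
Qed.

Lemma bmeas_sin (R : realType) (t : R) : bmeas (fun x => sin (t * x)).
Proof.
split; last by exists 1 => x; exact: sin_max.
apply: continuous_measurable_fun => x.
apply: continuous_comp; last exact: continuous_sin.
by apply: cvgM; [exact: cvg_cst|exact: cvg_id].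
Qed.

Lemma charfunE d (T : measurableType d) (R : realType) (P : probability T R)
    (X : T -> R) (t : R) :
  charfun P X t = Complex (\int[P]_w cos (t * X w)) (\int[P]_w sin (t * X w)).
Proof. by rewrite /charfun unlock. Qed.

Lemma charfun0 d (T : measurableType d) (R : realType) (P : probability T R)
    (X : T -> R) : charfun P X 0 = 1.
Proof.
rewrite charfunE; under eq_Rintegral do rewrite mul0r cos0.
under [X in Complex _ X]eq_Rintegral do rewrite mul0r sin0.
rewrite !Rintegral_cst// mul1r mul0r; congr Complex.
exact: (congr1 fine (@probability_setT _ _ _ P)).
Qed.

Lemma charfunN d (T : measurableType d) (R : realType) (P : probability T R)
    (X : T -> R) (t : R) :
  measurable_fun setT X -> charfun P X (- t) = (charfun P X t)^*%C.
Proof.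
move=> mX; rewrite !charfunE /=; congr Complex.
  by apply: eq_Rintegral => w _; rewrite mulNr cosN.
rewrite -mulN1r -RintegralZl//; last first.
  by apply: bmeas_integrable; exact: (bmeas_comp (bmeas_sin t)).
by apply: eq_Rintegral => w _; rewrite mulNr sinN mulN1r.
Qed.

(** Continuity is checked along sequences, where bounded convergence applies to the integrals of
    cosine and sine. *)
Lemma continuous_charfun d (T : measurableType d) (R : realType)
    (P : probability T R) (X : T -> R) : measurable_fun setT X ->
  continuous (fun t => complex.Re (charfun P X t)) /\
  continuous (fun t => complex.Im (charfun P X t)).
Proof.
move=> mX; split => t; apply/(@cvg_nbhsP _ R^o) => w wt.
- under eq_fun do rewrite charfunE/=; rewrite charfunE/=.
  have [|||_] := @bounded_convergence _ _ _ P (fun n x => cos (w n * X x))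
    (fun x => cos (t * X x)) 1; last by [].
  + by move=> n; exact: (bmeas_comp (bmeas_cos _) mX).1.
  + by move=> n x; exact: cos_max.
  + move=> x; apply: continuous_cvg; first exact: continuous_cos.
    by apply: cvgM => //; exact: cvg_cst.
- under eq_fun do rewrite charfunE/=; rewrite charfunE/=.
  have [|||_] := @bounded_convergence _ _ _ P (fun n x => sin (w n * X x))
    (fun x => sin (t * X x)) 1; last by [].
  + by move=> n; exact: (bmeas_comp (bmeas_sin _) mX).1.
  + by move=> n x; exact: sin_max.
  + move=> x; apply: continuous_cvg; first exact: continuous_sin.
    by apply: cvgM => //; exact: cvg_cst.
Qed.

Lemma same_law_charfun d d' (T : measurableType d) (T' : measurableType d')
    (R : realType) (P : probability T R) (Q : probability T' R)
    (X : T -> R) (Y : T' -> R) :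
  measurable_fun setT X -> measurable_fun setT Y -> same_law P Q X Y ->
  charfun P X = charfun Q Y.
Proof.
move=> mX mY XY; apply/funext => t; rewrite !charfunE.
rewrite (eq_law_Rintegral mX mY XY (bmeas_cos t)).
by rewrite (eq_law_Rintegral mX mY XY (bmeas_sin t)).
Qed.

(** A linear form is Borel on the plane, so equality of planar laws passes to it. The joint
    characteristic function at [(s, t)] is then the one of the form evaluated at 1. *)
Lemma same_law2_charfun d d' (T : measurableType d) (T' : measurableType d')
    (R : realType) (P : probability T R) (Q : probability T' R)
    (X1 X2 : T -> R) (Y1 Y2 : T' -> R) (s t : R) :
  measurable_fun setT X1 -> measurable_fun setT X2 ->
  measurable_fun setT Y1 -> measurable_fun setT Y2 ->
  same_law2 P Q X1 X2 Y1 Y2 ->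
  charfun P (fun w => s * X1 w + t * X2 w) = charfun Q (fun w => s * Y1 w + t * Y2 w).
Proof.
move=> mX1 mX2 mY1 mY2 XY.
have mL : measurable_fun setT (fun p : R * R => s * p.1 + t * p.2).
  by apply: measurable_funD; apply: measurable_funM => //; exact: measurable_cst.
apply: same_law_charfun.
- by apply: measurable_funD; apply: measurable_funM => //; exact: measurable_cst.
- by apply: measurable_funD; apply: measurable_funM => //; exact: measurable_cst.
- move=> B mB; apply: (XY ((fun p : R * R => s * p.1 + t * p.2) @^-1` B)).
  by rewrite -[X in measurable X]setTI; exact: mL.
Qed.

Lemma charfun_shift d (T : measurableType d) (R : realType) (P : probability T R)
    (X : T -> R) (a t : R) : measurable_fun setT X ->
  charfun P (fun w => X w + a) t =
  Complex (cos (a * t)) (sin (a * t)) * charfun P X t.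
Proof.
move=> mX; rewrite !charfunE.
have bc := bmeas_comp (bmeas_cos t) mX; have bs := bmeas_comp (bmeas_sin t) mX.
apply/eqP; rewrite eq_complex /=; apply/andP; split; apply/eqP.
- rewrite -mulNr -!RintegralZl//; try exact: bmeas_integrable.
  rewrite -RintegralD//; try by apply: bmeas_integrable; exact: bmeasZ.
  by apply: eq_Rintegral => w _; rewrite mulrDr cosD (mulrC a); ring.
- rewrite -!RintegralZl//; try exact: bmeas_integrable.
  rewrite -RintegralD//; try by apply: bmeas_integrable; exact: bmeasZ.
  by apply: eq_Rintegral => w _; rewrite mulrDr sinD (mulrC a); ring.
Qed.

(** With real and imaginary parts kept separate, cosine and sine of a sum of four angles are
    expanded into products, each product is factored by independence, and the result is matched with
    a product of four complex numbers. *)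
Lemma independent4_charfun d (T : measurableType d) (R : realType)
    (P : probability T R) (X1 X2 X3 X4 : T -> R) (t1 t2 t3 t4 : R) :
  measurable_fun setT X1 -> measurable_fun setT X2 ->
  measurable_fun setT X3 -> measurable_fun setT X4 ->
  independent4 P X1 X2 X3 X4 ->
  charfun P (fun w => t1 * X1 w + (t2 * X2 w + (t3 * X3 w + t4 * X4 w))) 1 =
  charfun P X1 t1 * (charfun P X2 t2 * (charfun P X3 t3 * charfun P X4 t4)).
Proof.
move=> m1 m2 m3 m4 ind.
pose trg (b : bool) t : R -> R := fun x => if b then cos (t * x) else sin (t * x).
have btrg b t : bmeas (trg b t).
  by rewrite /trg; case: b; [exact: bmeas_cos|exact: bmeas_sin].
pose term (p : R * (bool * bool * bool * bool)) w :=
  trg p.2.1.1.1 t1 (X1 w) * (trg p.2.1.1.2 t2 (X2 w) *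
  (trg p.2.1.2 t3 (X3 w) * trg p.2.2 t4 (X4 w))).
have bterm p : bmeas (term p).
  have bc b t X : measurable_fun setT X -> bmeas (fun w : T => trg b t (X w)).
    exact: bmeas_comp.
  by do !apply: bmeasM; exact: bc.
pose prod (p : R * (bool * bool * bool * bool)) :=
  (\int[P]_w trg p.2.1.1.1 t1 (X1 w)) * ((\int[P]_w trg p.2.1.1.2 t2 (X2 w)) *
  ((\int[P]_w trg p.2.1.2 t3 (X3 w)) * (\int[P]_w trg p.2.2 t4 (X4 w)))).
have lin s : bmeas (fun w => \sum_(p <- s) p.1 * term p w) /\
    \int[P]_w (\sum_(p <- s) p.1 * term p w) = \sum_(p <- s) p.1 * prod p.
  elim: s => [|p s [IHb IH]].
    have -> : (fun w => \sum_(p <- [::]) p.1 * term p w) = (fun=> 0).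
      by apply/funext => w; rewrite big_nil.
    by split; [exact: bmeas_cst|rewrite Rintegral_cst// mul0r big_nil].
  have -> : (fun w => \sum_(q <- p :: s) q.1 * term q w) =
      (fun w => p.1 * term p w + \sum_(q <- s) q.1 * term q w).
    by apply/funext => w; rewrite big_cons.
  split; first by apply: bmeasD => //; exact: bmeasZ.
  by rewrite bmeas_RintegralD// IH big_cons /term independent4_Rintegral.
pose c := true; pose s := false.
pose L1 : seq (R * (bool * bool * bool * bool)) :=
  (* A product with [k] sines carries the coefficient of [i ^+ k]: even [k] contributes to the real
     part [L1], odd [k] to the imaginary part [L2]. *)
  [:: (1, (c,c,c,c)); (-1, (c,c,s,s)); (-1, (c,s,c,s)); (-1, (c,s,s,c));
      (-1, (s,c,c,s)); (-1, (s,c,s,c)); (-1, (s,s,c,c)); (1, (s,s,s,s))].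
pose L2 : seq (R * (bool * bool * bool * bool)) :=
  [:: (1, (s,c,c,c)); (1, (c,s,c,c)); (1, (c,c,s,c)); (1, (c,c,c,s));
      (-1, (c,s,s,s)); (-1, (s,c,s,s)); (-1, (s,s,c,s)); (-1, (s,s,s,c))].
rewrite !charfunE; apply/eqP; rewrite eq_complex; apply/andP; split; apply/eqP.
- transitivity (\int[P]_w (\sum_(p <- L1) p.1 * term p w)).
    apply: eq_Rintegral => w _; rewrite mul1r !(cosD, sinD) !big_cons big_nil /term /trg/=.
    by ring.
  by rewrite (lin _).2 !big_cons big_nil /prod /trg/=; ring.
- transitivity (\int[P]_w (\sum_(p <- L2) p.1 * term p w)).
    apply: eq_Rintegral => w _; rewrite mul1r !(cosD, sinD) !big_cons big_nil /term /trg/=.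
    by ring.
  by rewrite (lin _).2 !big_cons big_nil /prod /trg/=; ring.
Qed.

(** * Uniqueness of characteristic functions *)

(** The real span of cosines and sines of all real frequencies. The base cases are the integrands of
    a characteristic function, and the last constructor has the shape of the linearity rule for
    integrals. *)
Inductive trig_poly (R : realType) : (R -> R) -> Prop :=
| trig_poly_cos t : trig_poly (fun x => cos (t * x))
| trig_poly_sin t : trig_poly (fun x => sin (t * x))
| trig_poly_lin k f g : trig_poly f -> trig_poly g ->
    trig_poly (fun x => k * f x + g x).

Lemma trig_polyZ (R : realType) (k : R) f :
  trig_poly f -> trig_poly (fun x => k * f x).
Proof.
move=> tf; have := trig_poly_lin k tf (trig_poly_sin 0).
by congr trig_poly; apply/funext => x; rewrite mul0r sin0 addr0.
Qed.

Lemma trig_poly_cst (R : realType) (k : R) : trig_poly (fun=> k).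
Proof.
have := trig_polyZ k (trig_poly_cos 0).
by congr trig_poly; apply/funext => x; rewrite mul0r cos0 mulr1.
Qed.

(** The product-to-sum formulas settle the base cases of a double induction; the rest is
    distributivity. *)
Lemma trig_polyM (R : realType) (f g : R -> R) :
  trig_poly f -> trig_poly g -> trig_poly (fun x => f x * g x).
Proof.
move=> tf tg; elim: tf => [s|s|k f1 f2 _ IH1 _ IH2].
- elim: tg => [t|t|k g1 g2 _ IH1 _ IH2].
  + have := trig_poly_lin 2^-1 (trig_poly_cos (s - t)) (trig_polyZ 2^-1 (trig_poly_cos (s + t))).
    congr trig_poly; apply/funext => x.
    by rewrite [(s - t) * x]mulrBl [(s + t) * x]mulrDl cosB cosD; field.
  + have := trig_poly_lin 2^-1 (trig_poly_sin (s + t)) (trig_polyZ (- 2^-1) (trig_poly_sin (s - t))).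
    congr trig_poly; apply/funext => x.
    by rewrite [(s - t) * x]mulrBl [(s + t) * x]mulrDl sinB sinD; field.
  + have := trig_poly_lin k IH1 IH2.
    by congr trig_poly; apply/funext => x; ring.
- elim: tg => [t|t|k g1 g2 _ IH1 _ IH2].
  + have := trig_poly_lin 2^-1 (trig_poly_sin (s + t)) (trig_polyZ 2^-1 (trig_poly_sin (s - t))).
    congr trig_poly; apply/funext => x.
    by rewrite [(s - t) * x]mulrBl [(s + t) * x]mulrDl sinB sinD; field.
  + have := trig_poly_lin 2^-1 (trig_poly_cos (s - t)) (trig_polyZ (- 2^-1) (trig_poly_cos (s + t))).
    congr trig_poly; apply/funext => x.
    by rewrite [(s - t) * x]mulrBl [(s + t) * x]mulrDl cosB cosD; field.
  + have := trig_poly_lin k IH1 IH2.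
    by congr trig_poly; apply/funext => x; ring.
- have := trig_poly_lin k IH1 IH2.
  by congr trig_poly; apply/funext => x; ring.
Qed.

Lemma trig_polyX (R : realType) (f : R -> R) n :
  trig_poly f -> trig_poly (fun x => f x ^+ n).
Proof.
move=> tf; elim: n => [|n IHn].
  by under eq_fun do rewrite expr0; exact: trig_poly_cst.
by under eq_fun do rewrite exprS; exact: trig_polyM.
Qed.

Lemma bmeas_trig_poly (R : realType) (f : R -> R) : trig_poly f -> bmeas f.
Proof.
elim=> [t|t|k f1 f2 _ b1 _ b2]; [exact: bmeas_cos|exact: bmeas_sin|].
by apply: bmeasD => //; exact: bmeasZ.
Qed.

Lemma trig_poly_Rintegral d d' (T : measurableType d) (T' : measurableType d')
    (R : realType) (P : probability T R) (Q : probability T' R)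
    (X : T -> R) (Y : T' -> R) (f : R -> R) :
  measurable_fun setT X -> measurable_fun setT Y -> charfun P X = charfun Q Y ->
  trig_poly f -> \int[P]_w f (X w) = \int[Q]_w f (Y w).
Proof.
move=> mX mY XY; elim=> [t|t|k f1 f2 t1 IH1 t2 IH2].
- by have := congr1 (fun g => g t) XY; rewrite !charfunE => -[].
- by have := congr1 (fun g => g t) XY; rewrite !charfunE => -[].
- have b1 := bmeas_trig_poly t1; have b2 := bmeas_trig_poly t2.
  by rewrite !bmeas_RintegralD ?IH1 ?IH2//; exact: bmeas_comp.
Qed.

(** * Limits behind the approximation of a ray *)

Lemma bernoulli_inequality (R : realDomainType) (x : R) n :
  -1 <= x -> 1 + n%:R * x <= (1 + x) ^+ n.
Proof.
move=> x1; elim: n => [|n IHn]; first by rewrite mul0r addr0 expr0.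
rewrite exprS (le_trans _ (ler_wpM2l _ IHn))//; last lra.
rewrite -natr1; have := sqr_ge0 x; have := ler0n R n.
set m : R := n%:R => m0 x20.
have : 0 <= m * x ^+ 2 by exact: mulr_ge0.
by rewrite expr2; lra.
Qed.

(** With [s] the square root of [z], Bernoulli's inequality at the inverse of [s] bounds
    [n * (1 - s) * s ^+ n] by 1. One factor [s ^+ n] of [z ^+ n] absorbs [n] and the other tends to
    0. *)
Lemma cvg_natmul_expr (R : realType) (z : R) :
  0 <= z < 1 -> (n%:R * z ^+ n : R) @[n --> \oo] --> (0 : R).
Proof.
move=> /andP[z0 z1].
pose s := Num.sqrt z.
have s0 : 0 <= s by exact: sqrtr_ge0.
have s1 : s < 1 by rewrite -(sqrtr1 R) ltr_sqrt.
have sz : z = s ^+ 2 by rewrite sqr_sqrtr.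
have bound n : (n%:R * (1 - s)) * s ^+ n <= 1.
  have [->|sn0] := eqVneq s 0.
    by case: n => [|n]; rewrite ?mul0r ?expr0n/= ?mulr0.
  have sp : 0 < s by rewrite lt_neqAle eq_sym sn0.
  have s10 : 0 <= s^-1 by rewrite invr_ge0.
  have H : 1 + n%:R * (s^-1 - 1) <= s^-1 ^+ n.
    have -> : s^-1 = 1 + (s^-1 - 1) by ring.
    by rewrite [1 + _ - 1]addrC addKr; apply: bernoulli_inequality; lra.
  have sn : 0 < s ^+ n by exact: exprn_gt0.
  rewrite -ler_pdivlMr// mul1r -exprVn.
  apply: le_trans H; rewrite -[leLHS]add0r lerD// ler_wpM2l//.
  have -> : s^-1 - 1 = (1 - s) / s by field.
  by rewrite ler_pdivlMr// ler_piMr// ?subr_ge0 ltW.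
apply: (@squeeze_cvgr _ _ _ _ (cst 0) (fun n => (1 - s)^-1 * s ^+ n)).
- apply: nearW => n /=; rewrite mulr_ge0 ?exprn_ge0//=.
  have s1' : 0 < 1 - s by rewrite subr_gt0.
  rewrite sz -exprM mulnC exprM expr2 mulrA ler_wpM2r ?exprn_ge0//.
  rewrite -[leRHS]mulr1 -ler_pdivrMl ?invr_gt0// invrK.
  by rewrite mulrA [_ * n%:R]mulrC.
- exact: cvg_cst.
- rewrite -(mulr0 (1 - s)^-1); apply: cvgM; first exact: cvg_cst.
  by apply: cvg_expr; rewrite ger0_norm.
Qed.

(* The factor [n] in the exponent makes the limit 0 also at the threshold
   [x = 1/2], so that no atom needs to be treated separately. *)
Lemma cvg_half_step (R : realType) (x : R) : 0 <= x <= 1 ->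
  ((1 - x ^+ n) ^+ (n * 2 ^ n)%N : R) @[n --> \oo] --> ((x < 2^-1)%R%:R : R).
Proof.
move=> /andP[x0 x1].
have u01 n : 0 <= x ^+ n <= 1 by rewrite exprn_ge0//= exprn_ile1.
have Nu n : (n * 2 ^ n)%N%:R * x ^+ n = n%:R * (2 * x) ^+ n :> R.
  by rewrite natrM natrX exprMn mulrA.
case: ltP => [xlt|xge].
(* Below the threshold, Bernoulli's inequality bounds the power from below by
   [1 - n * (2 * x) ^+ n], where [2 * x < 1]. *)
- apply: (@squeeze_cvgr _ _ _ _ (fun n => 1 - n%:R * (2 * x) ^+ n) (cst 1)).
  + apply: nearW => n /=; have /andP[un0 un1] := u01 n; apply/andP; split.
      rewrite -Nu -mulrN; apply: bernoulli_inequality; lra.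
    by rewrite exprn_ile1//; lra.
  + rewrite -[X in _ --> X]subr0; apply: cvgB; first exact: cvg_cst.
    by apply: cvg_natmul_expr; apply/andP; split; lra.
  + exact: cvg_cst.
- apply: (@squeeze_cvgr _ _ _ _ (cst 0) (@harmonic R)).
  + apply: nearW => n /=; have /andP[un0 un1] := u01 n; apply/andP; split.
      by rewrite exprn_ge0//; lra.
    rewrite -[leRHS]mul1r ler_pdivlMr//.
    (* From the threshold on, the same power of [1 + x ^+ n] is at least [n + 1] by Bernoulli's
       inequality, while its product with the power of [1 - x ^+ n] is at most 1. *)
    apply: (@le_trans _ _ ((1 - x ^+ n) ^+ (n * 2 ^ n)%N * (1 + x ^+ n) ^+ (n * 2 ^ n)%N)).
      rewrite ler_wpM2l ?exprn_ge0//; first lra.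
      apply: le_trans (bernoulli_inequality _ _); last lra.
      rewrite Nu -natr1 addrC lerD2l ler_peMr// exprn_ege1//; lra.
    rewrite -exprMn exprn_ile1//; first by rewrite mulr_ge0//; lra.
    by have := sqr_ge0 (x ^+ n); rewrite expr2; lra.
  + exact: cvg_cst.
  + exact: cvg_harmonic.
Qed.

(** Open right rays are stable under intersection, generate the Borel sets and exhaust the line, so
    two probabilities agreeing on them coincide. *)
Lemma same_law_ray d d' (T : measurableType d) (T' : measurableType d')
    (R : realType) (P : probability T R) (Q : probability T' R)
    (X : T -> R) (Y : T' -> R) :
  measurable_fun setT X -> measurable_fun setT Y ->
  (forall c, P (X @^-1` `]c, +oo[) = Q (Y @^-1` `]c, +oo[)) -> same_law P Q X Y.
Proof.
move=> mX mY.
pose MX : {mfun T >-> R} := mfun_Sub (mem_set mX).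
pose MY : {mfun T' >-> R} := mfun_Sub (mem_set mY).
move=> XY B mB.
apply: (@measure_unique _ R _ (@RGenOInfty.G R) (fun k => `](- k%:R)%R, +oo[%classic : set R)
  (RGenOInfty.measurableE R) _ _ _ (distribution P MX) (distribution Q MY)) => //.
- move=> _ _ [x ->] [y ->]; exists (Num.max x y).
  by apply/seteqP; split => z /=; rewrite !in_itv/= !andbT gt_max => /andP.
- by move=> k; exists (- k%:R).
- apply/seteqP; split => // x _; exists (Num.bound `|x|) => //=.
  rewrite in_itv/= andbT ltrNl (le_lt_trans (ler_norm _))// normrN.
  exact: (archi_boundP (normr_ge0 x)).
- by move=> _ [c ->]; exact: XY.
- by move=> k; rewrite (le_lt_trans (probability_le1 _ _)) ?ltry.
Qed.

(** For large [m] the quotient lies between -2 and 2, where sine has the sign of its argument. A ray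
    thus becomes a limit of periodic sets. *)
Lemma cvg_ray_step (R : realType) (y : R) :
  ((0 < sin (y / m.+1%:R))%R%:R : R) @[m --> \oo] --> ((0 < y)%R%:R : R).
Proof.
have small z : 0 < z -> \forall m \near \oo, 0 < sin (z / m.+1%:R).
  move=> z0; near=> m; apply: sin2_gt0; rewrite divr_gt0//=.
  rewrite ltr_pdivrMr// -ltr_pdivrMl// (@lt_le_trans _ _ m%:R)//; last first.
    by rewrite ler_nat.
  by near: m; exact: nbhs_infty_gtr.
case: (ltrgtP 0 y) => [y0|y0|<-].
- apply: cvg_near_cst; near=> m.
  by have -> : 0 < sin (y / m.+1%:R) by near: m; exact: small.
- apply: cvg_near_cst; near=> m.
  suff -> : (0 < sin (y / m.+1%:R)) = false by [].
  apply/negbTE; rewrite -leNgt -oppr_ge0 -sinN -mulNr ltW//.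
  by near: m; apply: small; rewrite oppr_gt0.
- by apply: cvg_near_cst; apply: nearW => m; rewrite mul0r sin0 ltxx.
Unshelve. all: by end_near. Qed.

Lemma charfun_same_law d d' (T : measurableType d) (T' : measurableType d')
    (R : realType) (P : probability T R) (Q : probability T' R)
    (X : T -> R) (Y : T' -> R) :
  measurable_fun setT X -> measurable_fun setT Y -> charfun P X = charfun Q Y ->
  same_law P Q X Y.
Proof.
move=> mX mY XY; apply: same_law_ray => // c.
pose s m : R -> R := fun x => sin ((x - c) / m.+1%:R).
(* The map sending [s] to [(1 - s) / 2] takes [-1, 1] to [0, 1] and positive values below 1/2, so as
   [n] grows [q m n] tends to the indicator [h m] of a positive sine; letting [m] grow then gives
   the ray. *)
pose q m n x : R := (1 - ((1 - s m x) / 2) ^+ n) ^+ (n * 2 ^ n)%N.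
have ts m : trig_poly (s m).
  have := trig_poly_lin (cos (c / m.+1%:R)) (trig_poly_sin (m.+1%:R)^-1)
    (trig_polyZ (- sin (c / m.+1%:R)) (trig_poly_cos (m.+1%:R)^-1)).
  congr trig_poly; apply/funext => x.
  by rewrite /s mulrBl sinB [_^-1 * x]mulrC; ring.
have tq m n : trig_poly (q m n).
  have t1 k f : trig_poly f -> trig_poly (fun x => 1 + k * f x : R).
    move=> tf; have := trig_poly_lin k tf (trig_poly_cst 1).
    by congr trig_poly; apply/funext => x; rewrite addrC.
  have := trig_polyX (n * 2 ^ n)%N
    (t1 (- 1) _ (trig_polyX n (trig_polyZ 2^-1 (t1 (-1) _ (ts m))))).
  by congr trig_poly; apply/funext => x; rewrite /q !mulN1r [_ / 2]mulrC.
have q01 m n x : `|q m n x| <= 1.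
  have := sin_geN1 ((x - c) / m.+1%:R); have := sin_le1 ((x - c) / m.+1%:R).
  rewrite -/(s m x) => s1 sN1.
  have u0 : 0 <= (1 - s m x) / 2 by lra.
  have u1 : (1 - s m x) / 2 <= 1 by lra.
  have v1 := exprn_ile1 n u0 u1; have v0 : 0 <= ((1 - s m x) / 2) ^+ n by exact: exprn_ge0.
  by rewrite ger0_norm /q ?exprn_ge0 ?exprn_ile1//; lra.
pose h m x : R := (0 < s m x)%R%:R.
have qh m x : q m n x @[n --> \oo] --> h m x.
  have := sin_geN1 ((x - c) / m.+1%:R); have := sin_le1 ((x - c) / m.+1%:R).
  rewrite -/(s m x) => s1 sN1.
  have := @cvg_half_step R ((1 - s m x) / 2) _.
  rewrite (_ : ((1 - s m x) / 2 < 2^-1) = (0 < s m x)); last by apply/idP/idP => ?; lra.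
  by apply; apply/andP; split; lra.
have bq m n : bmeas (q m n) by exact: bmeas_trig_poly.
have H m : \int[P]_w h m (X w) = \int[Q]_w h m (Y w).
  have [_ cX] := @bounded_convergence _ _ _ P (fun n w => q m n (X w))
    (fun w => h m (X w)) 1 (fun n => (bmeas_comp (bq m n) mX).1)
    (fun n w => q01 m n (X w)) (fun w => qh m (X w)).
  have [_ cY] := @bounded_convergence _ _ _ Q (fun n w => q m n (Y w))
    (fun w => h m (Y w)) 1 (fun n => (bmeas_comp (bq m n) mY).1)
    (fun n w => q01 m n (Y w)) (fun w => qh m (Y w)).
  apply: (cvg_unique _ cX) => //.
  rewrite (_ : (fun n => _) = (fun n => \int[Q]_w q m n (Y w)))//.
  by apply/funext => n; exact: trig_poly_Rintegral.
(* Measurability of the limit comes from bounded convergence, stated for some probability on the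
   line; the Dirac mass at 0 is an arbitrary choice. *)
have mh m : measurable_fun setT (h m).
  exact: (@bounded_convergence _ _ _ (dirac (0:R)) (q m) _ 1
    (fun n => (bq m n).1) (q01 m) (qh m)).1.1.
have h1 m x : `|h m x| <= 1 by rewrite normr_nat lern1 leq_b1.
have hc x : h m x @[m --> \oo] --> (\1_`]c, +oo[ x : R).
  rewrite indicE mem_setE in_itv/= andbT -subr_gt0.
  exact: cvg_ray_step.
have [_ cX] := @bounded_convergence _ _ _ P (fun n w => h n (X w))
  (fun w => \1_`]c, +oo[ (X w)) 1 (fun n => measurableT_comp (mh n) mX)
  (fun n w => h1 n (X w)) (fun w => hc (X w)).
have [_ cY] := @bounded_convergence _ _ _ Q (fun n w => h n (Y w))
  (fun w => \1_`]c, +oo[ (Y w)) 1 (fun n => measurableT_comp (mh n) mY)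
  (fun n w => h1 n (Y w)) (fun w => hc (Y w)).
have XYc : \int[P]_w (\1_`]c, +oo[ (X w) : R) = \int[Q]_w \1_`]c, +oo[ (Y w).
  apply: (cvg_unique _ cX) => //.
  by rewrite (_ : (fun n => _) = (fun n => \int[Q]_w h n (Y w)))//; apply/funext.
rewrite !Rintegral_indic_comp// in XYc.
have fP d0 (T0 : measurableType d0) (P0 : probability T0 R) (Z : T0 -> R) :
    measurable_fun setT Z -> P0 (Z @^-1` `]c, +oo[) \is a fin_num.
  move=> mZ; apply: fin_num_measure; rewrite -[X in measurable X]setTI; exact: mZ.
by rewrite -(fineK (fP _ _ P X mX)) -(fineK (fP _ _ Q Y mY)); congr EFin.
Qed.

(** * The functional equation *)

(** Continuity is tested on real and imaginary parts, so that only the topology of the real line is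
    involved. *)
Definition ccont (R : realType) (u : R -> R[i]) :=
  continuous (fun x => complex.Re (u x)) /\ continuous (fun x => complex.Im (u x)).

Lemma ccontM (R : realType) (u v : R -> R[i]) :
  ccont u -> ccont v -> ccont (fun x => u x * v x).
Proof.
move=> [ru iu] [rv iv].
have E x : u x * v x = Complex
    (complex.Re (u x) * complex.Re (v x) - complex.Im (u x) * complex.Im (v x))
    (complex.Re (u x) * complex.Im (v x) + complex.Im (u x) * complex.Re (v x)).
  by case: (u x) => a b; case: (v x) => c e.
split => x; under eq_fun do rewrite E/=.
- by apply: cvgB; apply: cvgM; [exact: ru|exact: rv|exact: iu|exact: iv].
- by apply: cvgD; apply: cvgM; [exact: ru|exact: iv|exact: iu|exact: rv].
Qed.

Lemma ccontV (R : realType) (u : R -> R[i]) :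
  (forall x, u x != 0) -> ccont u -> ccont (fun x => (u x)^-1).
Proof.
move=> u0 [ru iu].
pose N x := complex.Re (u x) ^+ 2 + complex.Im (u x) ^+ 2.
have N0 x : N x != 0.
  rewrite /N; have := u0 x; case: (u x) => a b /=; rewrite eq_complex/= => ab.
  by rewrite paddr_eq0 ?sqr_ge0// !sqrf_eq0.
have cN : continuous N.
  by move=> x; apply: cvgD; rewrite expr2; apply: cvgM; first [exact: ru|exact: iu].
have cNV x : (N y)^-1 @[y --> x] --> (N x)^-1 by apply: cvgV => //; exact: cN.
have E x : (u x)^-1 = Complex (complex.Re (u x) * (N x)^-1) (- complex.Im (u x) * (N x)^-1).
  by rewrite /N; case: (u x) => a b; apply/eqP; rewrite eq_complex/= mulNr !eqxx.
split => x; under eq_fun do rewrite E/=.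
- by apply: cvgM; [exact: ru|exact: cNV].
- by apply: cvgM; [apply: cvgN; exact: iu|exact: cNV].
Qed.

Lemma ccont_comp (R : realType) (u : R -> R[i]) (g : R -> R) :
  ccont u -> continuous g -> ccont (fun x => u (g x)).
Proof.
move=> [ru iu] cg; split => x.
- by apply: (@continuous_comp _ _ _ g (fun y => complex.Re (u y))); [exact: cg|exact: ru].
- by apply: (@continuous_comp _ _ _ g (fun y => complex.Im (u y))); [exact: cg|exact: iu].
Qed.

(** * Unit complex numbers and characters of the line *)

Definition expi (R : realType) (x : R) : R[i] := Complex (cos x) (sin x).

Lemma expi0 (R : realType) : expi (0 : R) = 1.
Proof. by rewrite /expi cos0 sin0. Qed.

Lemma expiD (R : realType) (x y : R) : expi (x + y) = expi x * expi y.
Proof. by apply/eqP; rewrite eq_complex/= cosD sinD addrC !eqxx/= addrC. Qed.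

Lemma expiNl (R : realType) (x : R) : expi (- x) * expi x = 1.
Proof. by rewrite -expiD addNr expi0. Qed.

Lemma ccont_expi (R : realType) (a : R) : ccont (fun x => expi (a * x)).
Proof.
split => x.
- apply: continuous_comp; last exact: continuous_cos.
  by apply: cvgM; [exact: cvg_cst|exact: cvg_id].
- apply: continuous_comp; last exact: continuous_sin.
  by apply: cvgM; [exact: cvg_cst|exact: cvg_id].
Qed.

(** The way invariance turns into a value: if a continuous function keeps one value along a sequence
    tending to 0, that value is the one at 0. *)
Lemma ccont_cvg0_eq (R : realType) (u : R -> R[i]) (r : nat -> R) (z : R[i]) :
  ccont u -> r @ \oo --> 0 -> (forall n, u (r n) = z) -> z = u 0.
Proof.
move=> [ru iu] r0 rz.
have aux (g : R -> R) y : continuous g -> (forall n, g (r n) = y) -> y = g 0.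
  move=> cg gr; have := cvg_comp _ _ r0 (cg 0).
  have -> : g \o r = cst y by apply/funext => n /=.
  by move/(cvg_unique _ (cvg_cst y)) => <-.
have rE := aux _ (complex.Re z) ru (fun n => congr1 _ (rz n)).
have iE := aux _ (complex.Im z) iu (fun n => congr1 _ (rz n)).
by apply/eqP; rewrite eq_complex rE iE !eqxx.
Qed.

(** Subtracting [f 1 * x] leaves an additive [g] vanishing on the integers, hence periodic and
    bounded by its values on [0, 1]. Since [g (n * x) = n * g x], boundedness forces [g = 0]. *)
Lemma additive_bounded_linear (R : realType) (f : R -> R) (M : R) :
  (forall x y, f (x + y) = f x + f y) ->
  (forall x, 0 <= x <= 1 -> `|f x| <= M) -> forall x, f x = f 1 * x.
Proof.
move=> fD fM.
pose g x := f x - f 1 * x.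
have gD x y : g (x + y) = g x + g y by rewrite /g fD; ring.
have g0 : g 0 = 0 by have := gD 0 0; rewrite addr0; lra.
have gN x : g (- x) = - g x by have := gD x (- x); rewrite subrr g0; lra.
have gMn n x : g (n%:R * x) = n%:R * g x.
  by elim: n => [|n IHn]; rewrite ?mul0r// -natr1 !mulrDl gD IHn !mul1r.
have g1 : g 1 = 0 by rewrite /g mulr1 subrr.
have gz (k : int) : g k%:~R = 0.
  case: k => n.
    by rewrite -[_%:~R]mulr1 gMn g1 mulr0.
  by rewrite NegzE mulrNz gN -[_%:~R]mulr1 gMn g1 mulr0 oppr0.
have gb x : `|g x| <= M + `|f 1|.
  have -> : g x = g (x - (Num.floor x)%:~R).
    by rewrite gD gN gz subr0.
  have /andP[x0 x1] : 0 <= x - (Num.floor x)%:~R <= 1.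
    have := floor_le_tmp x; have := floorD1_gt x.
    by rewrite intrD => ? ?; apply/andP; split; lra.
  rewrite /g (le_trans (ler_normB _ _))// lerD//.
    by apply: fM; rewrite x0.
  by rewrite normrM ler_piMr// ger0_norm.
move=> x; apply/eqP; rewrite -subr_eq0 -/(g x) -normr_le0.
rewrite leNgt; apply/negP => gx0.
have := archi_boundP (_ : 0 <= (M + `|f 1|) / `|g x|).
rewrite ltr_pdivrMr//; set n := Num.bound _ => /(_ _) H.
have {}H : M + `|f 1| < n%:R * `|g x|.
  by apply: H; rewrite divr_ge0// (le_trans _ (gb 0)).
have := gb (n%:R * x); rewrite gMn normrM normr_nat => H2.
by have := lt_le_trans H H2; rewrite ltxx.
Qed.

(** The remainder modulo the step [d / 2 ^+ n] lies between 0 and that step. *)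
Lemma dyadic_remainder (R : realType) (d x : R) : 0 < d ->
  (x - (Num.floor (x * 2 ^+ n / d))%:~R * (d / 2 ^+ n) : R) @[n --> \oo] --> (0 : R).
Proof.
move=> d0; apply: (@squeeze_cvgr _ _ _ _ (cst 0) (fun n => d * 2^-1 ^+ n)).
- apply: nearW => n; set y := x * 2 ^+ n / d; set h := d / 2 ^+ n.
  have h0 : 0 < h by rewrite divr_gt0// exprn_gt0.
  have -> : x - (Num.floor y)%:~R * h = (y - (Num.floor y)%:~R) * h.
    rewrite mulrBl; congr (_ - _); rewrite /y /h; field.
    by rewrite expf_neq0//= gt_eqF.
  have := floor_le_tmp y; have := floorD1_gt y; rewrite intrD => y1 y0.
  rewrite exprVn -/h; clearbody y; apply/andP; split.
    by apply: mulr_ge0; [lra|exact: ltW].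
  by apply: ler_piMl; [exact: ltW|lra].
- exact: cvg_cst.
- rewrite -(mulr0 d); apply: cvgM; first exact: cvg_cst.
  by apply: cvg_expr; rewrite ger0_norm// invf_lt1// ltr1n.
Qed.

(* The angle is read off at a small [d]; positivity of the real part selects the
   right square root at each halving, and dyadic multiples of [d] are dense. *)
Lemma character_expi (R : realType) (u : R -> R[i]) :
  ccont u -> (forall x, u (- x) = (u x)^*%C) -> u 0 = 1 ->
  (forall x y, u (x + y) = u x * u y) -> exists a, forall x, u x = expi (a * x).
Proof.
move=> cu uN u0 uD.
have [d d0 du] : exists2 d : R, 0 < d & forall x, 0 <= x <= d -> 0 < complex.Re (u x).
  have c0 : complex.Re (u x) @[x --> (0:R)] --> complex.Re (u 0) := cu.1 0.
  rewrite u0 /= in c0.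
  have /nbhs_ballP[e /= e0 eu] : \forall x \near (0 : R), 0 < complex.Re (u x).
    by apply: (cvgr_gt _ c0); exact: ltr01.
  exists (e / 2) => [|x /andP[x0 xe]]; first by rewrite divr_gt0.
  by apply: eu; rewrite /ball/= sub0r normrN ger0_norm//; lra.
have norm1 x : complex.Re (u x) ^+ 2 + complex.Im (u x) ^+ 2 = 1.
  have : u x * (u x)^*%C = 1 by rewrite -uN -uD subrr u0.
  case: (u x) => a b /eqP; rewrite eq_complex/= => /andP[/eqP + _].
  by move=> <-; ring.
(* The arcsine is an angle with nonnegative cosine; as [u d] has modulus 1 and positive real part,
   it is an argument of [u d]. *)
pose q := asin (complex.Im (u d)).
have Im1 : -1 < complex.Im (u d) < 1.
  have := norm1 d; have := du d; rewrite lexx ltW// => /(_ isT).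
  set a := complex.Re _; set b := complex.Im _ => a0 ab.
  by apply/andP; split; nra.
have /andP[ImN ImL] := Im1.
have q1 : q < pi / 2 by apply: asin_ltpi2; rewrite ImL ltW.
have q2 : - (pi / 2) < q by apply: asin_gtNpi2; rewrite ImN ltW.
have uq : u d = expi q.
  rewrite /expi /q asinK ?in_itv/= ?ltW// cos_asin ?ltW//.
  have -> : 1 - complex.Im (u d) ^+ 2 = complex.Re (u d) ^+ 2.
    by rewrite -(norm1 d); ring.
  rewrite sqrtr_sqr gtr0_norm; last by apply: du; rewrite lexx ltW.
  by case: (u d).
have dy n : u (d / 2 ^+ n) = expi (q / 2 ^+ n).
  elim: n => [|n IHn]; first by rewrite !expr0 !divr1.
  have half (x : R) : x / 2 ^+ n = x / 2 ^+ n.+1 + x / 2 ^+ n.+1.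
    by rewrite exprS; field; rewrite expf_neq0.
  have e2n : 1 <= (2 : R) ^+ n.+1 by rewrite exprn_ege1// ler1n.
  have p0 : 0 < complex.Re (u (d / 2 ^+ n.+1)).
    apply: du; apply/andP; split; first by rewrite divr_ge0 ?exprn_ge0// ltW.
    by rewrite ler_pdivrMr ?exprn_gt0// ler_peMr// ltW.
  have p1 : 0 < complex.Re (expi (q / 2 ^+ n.+1)).
    rewrite /=; apply: cos_gt0_pihalf; rewrite -ltr_norml normrM normfV.
    rewrite [X in _ / X]ger0_norm ?exprn_ge0//.
    apply: (@le_lt_trans _ _ `|q|); last by rewrite ltr_norml q1 q2.
    by rewrite ler_pdivrMr ?exprn_gt0// ler_peMr.
  move: IHn; rewrite (half d) (half q) uD expiD => /eqP.
  rewrite -!expr2 -subr_eq0 subr_sqr mulf_eq0 subr_eq0 => /orP[/eqP//|].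
  rewrite addr_eq0 => /eqP H; move: p0; rewrite H => p0.
  exfalso; have := addr_gt0 p0 p1.
  by case: (expi _) => a b /=; rewrite addNr ltxx.
exists (q / d) => x.
(* Dividing by the candidate leaves a continuous character equal to 1 at all dyadic multiples of
   [d], hence everywhere. *)
pose v x := u x * expi (- (q / d) * x).
have cv : ccont v by apply: ccontM => //; exact: ccont_expi.
have vD x1 x2 : v (x1 + x2) = v x1 * v x2.
  by rewrite /v uD mulrDr expiD; ring.
have v0 : v 0 = 1 by rewrite /v u0 mulr0 expi0 mulr1.
have vdy n : v (d / 2 ^+ n) = 1.
  rewrite /v dy; have -> : - (q / d) * (d / 2 ^+ n) = - (q / 2 ^+ n).
    by field; rewrite expf_neq0//= gt_eqF.
  by rewrite mulrC expiNl.
have vnat y n : v y = 1 -> v (n%:R * y) = 1.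
  by move=> vy; elim: n => [|n IHn]; rewrite ?mul0r// -natr1 mulrDl vD IHn !mul1r.
have vint y (k : int) : v y = 1 -> v (k%:~R * y) = 1.
  move=> vy; case: k => n; first exact: vnat.
  have := vD (n.+1%:R * y) (- (n.+1%:R * y)).
  by rewrite subrr v0 (vnat _ _ vy) mul1r NegzE mulrNz mulNr => <-.
have vx1 : v x = v 0.
  apply: (ccont_cvg0_eq cv (dyadic_remainder x d0)) => n.
  set k := Num.floor _.
  by rewrite -[RHS]mulr1 -(vint _ (- k) (vdy n)) -vD mulrNz mulNr.
have : v x * expi (q / d * x) = expi (q / d * x) by rewrite vx1 v0 mul1r.
by rewrite /v -mulrA mulNr expiNl mulr1.
Qed.

(** * The equation satisfied by the ratios *)

Section functional_equation.
Context {R : realType} (a2 a3 b2 b3 : R) (u1 u u4 : R -> R[i]).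
Hypotheses (a20 : a2 != 0) (a30 : a3 != 0) (b20 : b2 != 0).
Hypotheses (cu : ccont u) (uN : forall x, u (- x) = (u x)^*%C) (u01 : u 0 = 1)
  (u_neq0 : forall x, u x != 0).
Hypothesis eqn : forall s t,
  u1 s * (u (a2 * s + b2 * t) * (u (a3 * s + b3 * t) * u4 t)) = 1.

Let F s t := u (a2 * s + b2 * t) * u (a3 * s + b3 * t).

(** The equation makes [F s t] a function of [s] times a function of [t]; exchanging increments
    eliminates [u1] and [u4]. *)
Let F_exchange s t h k : F (s + h) (t + k) * F s t = F (s + h) t * F s (t + k).
Proof.
have E0 x y : u1 x * u4 y * F x y = 1 by rewrite -(eqn x y) /F; ring.
have E x y : F x y = (u1 x * u4 y)^-1.
  (* That [u1 x * u4 y] is nonzero follows from the product being 1. *)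
  have := oner_neq0 R[i]; rewrite -(E0 x y) mulf_eq0 negb_or => /andP[z _].
  by apply: (mulfI z); rewrite E0 mulfV.
by rewrite !E !invfM; ring.
Qed.

Lemma nonproportional_character : a2 * b3 != a3 * b2 ->
  a2 * b2 + a3 * b3 != 0 -> forall x y, u (x + y) = u x * u y.
Proof.
move=> det ab.
have D0 : a2 * b3 - a3 * b2 != 0 by rewrite subr_eq0.
(* The multiplicative second difference of [u] at [x]; [B] below is its value at the base point
   0. *)
pose D x h k := u (x + h + k) * u x / (u (x + h) * u (x + k)).
have Dxy x y h k : D x (a2 * h) (b2 * k) * D y (a3 * h) (b3 * k) = 1.
  (* Cramer's rule: independence of the coefficient pairs makes [x] and [y] arbitrary. *)
  pose s := (b3 * x - b2 * y) / (a2 * b3 - a3 * b2).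
  pose t := (a2 * y - a3 * x) / (a2 * b3 - a3 * b2).
  have xE : x = a2 * s + b2 * t by rewrite /s /t; field.
  have yE : y = a3 * s + b3 * t by rewrite /s /t; field.
  have := F_exchange s t h k; rewrite /F.
  rewrite (_ : a2 * (s + h) + b2 * (t + k) = x + a2 * h + b2 * k); last by rewrite xE; ring.
  rewrite (_ : a3 * (s + h) + b3 * (t + k) = y + a3 * h + b3 * k); last by rewrite yE; ring.
  rewrite (_ : a2 * (s + h) + b2 * t = x + a2 * h); last by rewrite xE; ring.
  rewrite (_ : a3 * (s + h) + b3 * t = y + a3 * h); last by rewrite yE; ring.
  rewrite (_ : a2 * s + b2 * (t + k) = x + b2 * k); last by rewrite xE; ring.
  rewrite (_ : a3 * s + b3 * (t + k) = y + b3 * k); last by rewrite yE; ring.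
  rewrite -xE -yE => H; rewrite /D mulf_div.
  rewrite (_ : _ * _ * (_ * _) =
    u (x + a2 * h + b2 * k) * u (y + a3 * h + b3 * k) * (u x * u y)); last by ring.
  by rewrite H mulrACA divff// !mulf_neq0.
pose B h k := u (h + k) / (u h * u k).
(* The relation at [(x, 0)] is compared with the one at [(0, 0)]: the common factor [z] cancels, so
   [D] does not depend on its base point. The increments are divided by [a2] and [b2] to become [h]
   and [k]. *)
have DB x h k : D x h k = B h k.
  have D0B : D 0 h k = B h k by rewrite /D /B u01 !add0r mulr1.
  have hE : h = a2 * (h / a2) by field.
  have kE : k = b2 * (k / b2) by field.
  have e1 := Dxy x 0 (h / a2) (k / b2); have e2 := Dxy 0 0 (h / a2) (k / b2).
  rewrite -hE -kE D0B in e1 e2.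
  set z := D 0 (a3 * _) _ in e1 e2.
  have z0 : z != 0.
    apply/negP => /eqP z0; move: e1; rewrite z0 mulr0 => /eqP.
    by rewrite eq_sym oner_eq0.
  by apply: (mulIf z0); rewrite e1.
have BC h k : B h k = B k h by rewrite /B addrC [u h * _]mulrC.
have BD h h' k : B (h + h') k = B h k * B h' k.
  have := DB h' h k; rewrite /D /B [h' + h]addrC => H.
  have -> : u (h + h' + k) = u (h + k) / (u h * u k) * (u (h + h') * u (h' + k)) / u h'.
    by rewrite -H; field; rewrite !u_neq0.
  by field; rewrite !u_neq0.
have B0 k : B 0 k = 1 by rewrite /B u01 add0r mul1r divff.
have Bneq0 h k : B h k != 0 by rewrite mulf_neq0// invr_neq0// mulf_neq0.
have BN h k : B (- h) k = (B h k)^-1.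
  by apply: (mulIf (Bneq0 h k)); rewrite mulVf// -BD addNr B0.
(* Conjugation changes the sign of both arguments, and the two resulting inverses cancel. *)
have Bconj h k : (B h k)^*%C = B h k.
  have -> : (B h k)^*%C = B (- h) (- k).
    by rewrite /B -opprD !uN fmorph_div rmorphM.
  by rewrite BN BC BN invrK BC.
have BIm h k : complex.Im (B h k) = 0.
  have := Bconj h k; case: (B h k) => x y /= [] /eqP.
  by rewrite eq_sym -addr_eq0 -mulr2n mulrn_eq0/= => /eqP.
pose b h k := complex.Re (B h k).
have Bb h k : B h k = Complex (b h k) 0 by rewrite /b -(BIm h k); case: (B h k).
have bD h h' k : b (h + h') k = b h k * b h' k.
  by rewrite /b BD !Bb /= mul0r subr0.
have bC h k : b h k = b k h by rewrite /b BC.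
(* Halving [h] exhibits a real value of [b] as a nonzero square. *)
have b0 h k : 0 < b h k.
  have -> : h = h / 2 + h / 2 by field.
  rewrite bD -expr2 lt_neqAle sqr_ge0 andbT eq_sym sqrf_eq0.
  by have := Bneq0 (h / 2) k; rewrite Bb eq_complex/= eqxx andbT.
have cb k : continuous (fun h => ln (b h k)).
  have [cB _] : ccont (fun h => B h k).
    apply: ccontM; last apply: ccontV.
    - apply: ccont_comp => // x; apply: cvgD; [exact: cvg_id|exact: cvg_cst].
    - by move=> x; rewrite mulf_neq0.
    - by apply: ccontM => //; split => x; exact: cvg_cst.
  by move=> x; apply: continuous_cvg; [exact: continuous_ln|exact: cB].
(* The logarithm is additive in [h], and continuity on the compact [0, 1] supplies the bound needed
   for linearity. *)
have lnlin k h : ln (b h k) = ln (b 1 k) * h.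
  have [c _ cM] := @EVT_max R (fun h => `|ln (b h k)|) 0 1 ler01
    (continuous_subspaceT (fun x => cvg_norm (cb k x))).
  apply: (@additive_bounded_linear R (fun h => ln (b h k)) `|ln (b c k)|) => [x y|x x01].
    by rewrite bD lnM ?posrE ?b0.
  by apply: cM; rewrite in_itv.
have lnb h k : ln (b h k) = ln (b 1 1) * (h * k).
  by rewrite lnlin bC lnlin; ring.
(* For unit increments the relation reads [ln (b 1 1) * (a2 * b2 + a3 * b3) = 0]. *)
have ln0 : ln (b 1 1) = 0.
  have := Dxy 0 0 1 1; rewrite !DB !mulr1 !Bb => /eqP; rewrite eq_complex/= => /andP[/eqP + _].
  rewrite mulr0 subr0 => /(congr1 (@ln R)).
  rewrite lnM ?posrE// ln1 (lnb a2) (lnb a3) -mulrDr.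
  by move=> /eqP; rewrite mulf_eq0 (negbTE ab) orbF => /eqP.
move=> x y; have : B x y = 1.
  rewrite Bb; suff -> : b x y = 1 by [].
  by apply: (@ln_inj R); rewrite ?posrE// ln1 lnb ln0 mul0r.
by rewrite /B => /(congr1 (fun z => z * (u x * u y))); rewrite divfK ?mulf_neq0// mul1r.
Qed.

(** Here [F s t] depends on [a2 * s + b2 * t] alone, through [w], and exchanging increments from the
    origin makes [w] a character. It remains to recover [u] from [w]. *)
Lemma proportional_expi : a2 * b3 = a3 * b2 -> (a2, b2) != (- a3, - b3) ->
  exists a, forall x, u x = expi (a * x).
Proof.
move=> det neq; pose c := a3 / a2.
have a3E : a3 = c * a2 by rewrite /c divfK.
have b3E : b3 = c * b2 by apply: (mulfI a20); rewrite det a3E; ring.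
have c0 : c != 0 by rewrite mulf_neq0// invr_neq0.
(* The value [c = -1] is exactly the excluded case of opposite pairs. *)
have c1 : 1 + c != 0.
  apply: contra_neq neq => c1; rewrite a3E b3E.
  have -> : c = -1 by lra.
  by rewrite !mulN1r !opprK.
pose w x := u x * u (c * x).
have FE s t : F s t = w (a2 * s + b2 * t).
  by rewrite /F /w a3E b3E; congr (_ * u _); ring.
have w0 : w 0 = 1 by rewrite /w mulr0 u01 mulr1.
have wD x y : w (x + y) = w x * w y.
  have := F_exchange 0 0 (x / a2) (y / b2).
  rewrite !FE !add0r !mulr0 !addr0 !add0r w0 mulr1.
  by rewrite ![_ * (_ / _)]mulrC !divfK.
have ccs (k : R) : continuous (fun x : R => k * x).
  by move=> x; apply: cvgM; [exact: cvg_cst|exact: cvg_id].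
have cw : ccont w by apply: ccontM => //; exact: ccont_comp.
have wN x : w (- x) = (w x)^*%C by rewrite /w mulrN !uN rmorphM.
have [kap wE] := character_expi cw wN w0 wD.
(* Since [a * (1 + c) = kap], the exponentials in [r y * r (c * y)] cancel [w y]. *)
exists (kap / (1 + c)) => x; set a := kap / (1 + c).
pose r x := u x * expi (- a * x).
have cr : ccont r by apply: ccontM => //; exact: ccont_expi.
have r0 : r 0 = 1 by rewrite /r u01 mulr0 expi0 mulr1.
have rc y : r y * r (c * y) = 1.
  have -> : r y * r (c * y) = w y * (expi (- a * y) * expi (- a * (c * y))).
    by rewrite /r /w; ring.
  rewrite -expiD wE (_ : - a * y + _ = - (kap * y)) 1?mulrC ?expiNl//.
  by rewrite /a; field.
suff rx : r x = 1.
  have := congr1 (fun z => z * expi (a * x)) rx.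
  by rewrite /r -mulrA mulNr expiNl mulr1 mul1r.
have rcc y : r (c ^+ 2 * y) = r y.
  have rcy0 : r (c * y) != 0.
    by apply/negP => /eqP z; have := rc y; rewrite z mulr0 => /eqP; rewrite eq_sym oner_eq0.
  by apply: (mulfI rcy0); rewrite expr2 -mulrA rc mulrC rc.
have rccn n y : r ((c ^+ 2) ^+ n * y) = r y.
  by elim: n => [|n IHn]; rewrite ?mul1r// exprS -mulrA rcc.
have geo (q : R) : `|q| < 1 -> q ^+ n * x @[n --> \oo] --> (0 : R).
  move=> q1; rewrite -[X in _ --> X](mul0r x).
  by apply: cvgM; [exact: cvg_expr|exact: cvg_cst].
(* Invariance of [r] under [c ^+ 2] is iterated in whichever direction contracts towards 0. *)
have [cn1|cn1|c_1] := ltgtP `|c| 1.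
- rewrite -r0; apply: (ccont_cvg0_eq cr (geo (c ^+ 2) _)) => //.
  by rewrite normrX expr_lt1.
- rewrite -r0; apply: (ccont_cvg0_eq cr (geo (c ^- 2) _)) => [|n].
    by rewrite normfV normrX invf_lt1 ?exprn_egt1// exprn_gt0// (lt_trans ltr01).
  by rewrite -(rccn n) mulrA -exprMn mulfV ?expf_neq0// expr1n mul1r.
(* No direction contracts when [c = 1], but then [r y ^+ 2 = 1]: a value -1 at [x] would make the
   real part of [r] vanish between 0 and [x], against [r] being 1 or -1 everywhere. *)
- have {}c_1 : c = 1.
    have : `|c| ^+ 2 = 1 by rewrite c_1 expr1n.
    rewrite real_normK ?num_real// => /eqP.
    rewrite sqrf_eq1 => /orP[/eqP//|/eqP c_1'].
    by move: c1; rewrite c_1' subrr eqxx.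
  have pm y : r y = 1 \/ r y = - 1.
    have := rc y; rewrite c_1 mul1r -expr2 => /eqP.
    by rewrite sqrf_eq1 => /orP[] /eqP ->; [left|right].
  case: (pm x) => // rxN.
  have cphi : continuous (fun y => complex.Re (r (x * y))) by exact: (ccont_comp cr (ccs x)).1.
  have [|z _ Re0] := @IVT R (fun y => complex.Re (r (x * y))) 0 1 0 ler01
    (continuous_subspaceT cphi).
    rewrite mulr0 mulr1 r0 rxN /=.
    by rewrite ge_min le_max lerN10 ler01 orbT.
  by case: (pm (x * z)) => H; move: Re0; rewrite H /= => /eqP;
    rewrite ?oppr_eq0 oner_eq0.
Qed.
End functional_equation.

(** * From ratios of characteristic functions to laws *)

Lemma same_law_of_charfun_ratio d d' (T : measurableType d)
    (T' : measurableType d') (R : realType) (P : probability T R)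
    (Q : probability T' R) (X : T -> R) (Y : T' -> R) (a : R) :
  measurable_fun setT X -> measurable_fun setT Y ->
  (forall t, charfun Q Y t = expi (a * t) * charfun P X t) ->
  same_law Q P Y (fun w => X w + a).
Proof.
move=> mX mY H; apply: charfun_same_law => //.
  by apply: measurable_funD => //; exact: measurable_cst.
by apply/funext => t; rewrite charfun_shift.
Qed.

Lemma charfun_linear_forms d (T : measurableType d) (R : realType)
    (P : probability T R) (X1 X2 X3 X4 : T -> R) (a2 a3 b2 b3 s t : R) :
  measurable_fun setT X1 -> measurable_fun setT X2 ->
  measurable_fun setT X3 -> measurable_fun setT X4 ->
  independent4 P X1 X2 X3 X4 ->
  charfun P (fun w => s * (X1 w + a2 * X2 w + a3 * X3 w) +
                      t * (b2 * X2 w + b3 * X3 w + X4 w)) 1 =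
  charfun P X1 s * (charfun P X2 (a2 * s + b2 * t) *
    (charfun P X3 (a3 * s + b3 * t) * charfun P X4 t)).
Proof.
move=> m1 m2 m3 m4 ind; rewrite -independent4_charfun//.
by congr (charfun P _ 1); apply/funext => w; ring.
Qed.

Theorem theorem2p1 (R : realType) (a2 a3 b2 b3 : R)
  (d : measure_display) (T : measurableType d) (P : probability T R)
  (d' : measure_display) (T' : measurableType d') (Q : probability T' R)
  (xi1 xi2 xi3 xi4 : {RV P >-> R}) (eta1 eta2 eta3 eta4 : {RV Q >-> R}) :
  a2 != 0 -> a3 != 0 -> b2 != 0 -> b3 != 0 ->
  a2 * b2 != - (a3 * b3) ->
  (a2, b2) != (- a3, - b3) ->
  independent4 P xi1 xi2 xi3 xi4 ->
  charfun_nowhere_zero P xi1 -> charfun_nowhere_zero P xi2 ->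
  charfun_nowhere_zero P xi3 -> charfun_nowhere_zero P xi4 ->
  same_law P P xi2 xi3 ->
  independent4 Q eta1 eta2 eta3 eta4 ->
  charfun_nowhere_zero Q eta1 -> charfun_nowhere_zero Q eta2 ->
  charfun_nowhere_zero Q eta3 -> charfun_nowhere_zero Q eta4 ->
  same_law Q Q eta2 eta3 ->
  same_law2 P Q
    (fun w => xi1 w + a2 * xi2 w + a3 * xi3 w) (fun w => b2 * xi2 w + b3 * xi3 w + xi4 w)
    (fun w => eta1 w + a2 * eta2 w + a3 * eta3 w) (fun w => b2 * eta2 w + b3 * eta3 w + eta4 w) ->
  exists alpha1 alpha2 alpha3 alpha4 : R,
    [/\ same_law Q P eta1 (fun w => xi1 w + alpha1),
        same_law Q P eta2 (fun w => xi2 w + alpha2),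
        same_law Q P eta3 (fun w => xi3 w + alpha3) &
        same_law Q P eta4 (fun w => xi4 w + alpha4)].
Proof.
move=> a20 a30 b20 b30 ab neq indP fx1 fx2 fx3 fx4 lawP indQ fe1 fe2 fe3 fe4 lawQ law2.
have mx1 : measurable_fun setT xi1 by exact: measurable_funPT.
have mx2 : measurable_fun setT xi2 by exact: measurable_funPT.
have mx3 : measurable_fun setT xi3 by exact: measurable_funPT.
have mx4 : measurable_fun setT xi4 by exact: measurable_funPT.
have me1 : measurable_fun setT eta1 by exact: measurable_funPT.
have me2 : measurable_fun setT eta2 by exact: measurable_funPT.
have me3 : measurable_fun setT eta3 by exact: measurable_funPT.
have me4 : measurable_fun setT eta4 by exact: measurable_funPT.
have f32 : charfun P xi3 = charfun P xi2 by rewrite (same_law_charfun mx2 mx3 lawP).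
have g32 : charfun Q eta3 = charfun Q eta2 by rewrite (same_law_charfun me2 me3 lawQ).
pose u1 s := charfun Q eta1 s / charfun P xi1 s.
pose u s := charfun Q eta2 s / charfun P xi2 s.
pose u4 s := charfun Q eta4 s / charfun P xi4 s.
have mZ d0 (T0 : measurableType d0) (k : R) (X : T0 -> R) :
    measurable_fun setT X -> measurable_fun setT (fun w => k * X w).
  by move=> mX; apply: measurable_funM => //; exact: measurable_cst.
(* The joint characteristic functions at [(s, t)] agree and factor by independence; dividing one
   factorization by the other gives the equation for the ratios. *)
have eqn s t : u1 s * (u (a2 * s + b2 * t) * (u (a3 * s + b3 * t) * u4 t)) = 1.
  have H : charfun Q eta1 s * (charfun Q eta2 (a2 * s + b2 * t) *
        (charfun Q eta2 (a3 * s + b3 * t) * charfun Q eta4 t)) =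
      charfun P xi1 s * (charfun P xi2 (a2 * s + b2 * t) *
        (charfun P xi2 (a3 * s + b3 * t) * charfun P xi4 t)).
    rewrite -{2}g32 -{2}f32 -!charfun_linear_forms//.
    apply: (congr1 (fun f => f 1)); apply/esym.
    apply: same_law2_charfun law2.
    - by apply: measurable_funD; [apply: measurable_funD|]; rewrite //; exact: mZ.
    - by apply: measurable_funD; [apply: measurable_funD|]; rewrite //; exact: mZ.
    - by apply: measurable_funD; [apply: measurable_funD|]; rewrite //; exact: mZ.
    - by apply: measurable_funD; [apply: measurable_funD|]; rewrite //; exact: mZ.
  rewrite /u1 /u /u4 !mulf_div H divff// !mulf_neq0//.
have u_neq0 x : u x != 0 by rewrite mulf_neq0 ?invr_neq0.
have u01 : u 0 = 1 by rewrite /u !charfun0 divff// oner_neq0.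
have uN x : u (- x) = (u x)^*%C by rewrite /u !charfunN// fmorph_div.
have cu : ccont u.
  apply: ccontM; first exact: continuous_charfun.
  by apply: ccontV => //; exact: continuous_charfun.
(* The determinant of the coefficient pairs separates the cases: [neq] enters the proportional one,
   [ab] the independent one. *)
have [al ualE] : exists a, forall x, u x = expi (a * x).
  have [det|det] := eqVneq (a2 * b3) (a3 * b2).
    exact: (proportional_expi a20 a30 b20 cu uN u01 eqn det neq).
  apply: character_expi => //.
  apply: (nonproportional_character a20 b20 cu uN u01 u_neq0 eqn det).
  by rewrite addr_eq0.
have ratio (z x : R[i]) (y : R) : x != 0 -> z / x = expi y -> z = expi y * x.
  by move=> x0 <-; rewrite divfK.
have inv (z : R[i]) (y : R) : z * expi y = 1 -> z = expi (- y).
  by move=> H; rewrite -[RHS]mul1r -H -mulrA [expi y * _]mulrC expiNl mulr1.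
have u10 : u1 0 = 1 by rewrite /u1 !charfun0 divff// oner_neq0.
have u40 : u4 0 = 1 by rewrite /u4 !charfun0 divff// oner_neq0.
have H2 t : charfun Q eta2 t = expi (al * t) * charfun P xi2 t.
  by apply: ratio; [exact: fx2|exact: ualE].
(* Putting [t = 0] in the equation determines [u1] from [u], and [s = 0] determines [u4]; this gives
   the first and last shifts. *)
exists (- (al * (a2 + a3))), al, al, (- (al * (b2 + b3))).
split; apply: same_law_of_charfun_ratio => // t.
- apply: ratio => //; rewrite -/(u1 t); have := eqn t 0.
  by rewrite u40 !mulr0 !addr0 mulr1 !ualE -expiD => /inv ->; congr expi; ring.
- by rewrite g32 f32.
- apply: ratio => //; rewrite -/(u4 t); have := eqn 0 t.
  rewrite u10 !mulr0 !add0r mul1r !ualE mulrA -expiD mulrC => /inv ->.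
  by congr expi; ring.
Qed.
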